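(* Membership in every Magnus submonoid of $$G=\langle a,t\mid t(ata^{-1})=(ata^{-1})t\rangle$$ is decidable.
   Context: The group is regarded as a one-relator group with generating set $\{a,t\}$ and relator $r=t(ata^{-1})\bigl((ata^{-1})t\bigr)^{-1}$. For a one-relator group $G=\langle A\mid r=1\rangle$ in which every letter of $A$ appears in $r$, a Magnus submonoid of $G$ is a submonoid generated by a strict subset of $A\cup A^{-1}$. For a group $G$ generated by a finite set $A$ and a finitely generated submonoid $M\leq G$, membership in $M$ is decidable if there is an algorithm that takes any word over $A\cup A^{-1}$ and decides whether the element of $G$ it represents belongs to $M$. *)

(* Defs.v *)
From HB Require Import structures.
From mathcomp Require Import all_boot.
From mathcomp Require Import boolp classical_sets.

Set Implicit Arguments.
Unset Strict Implicit.
Unset Printing Implicit Defensive.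

Local Open Scope nat_scope.

(* The class of total recursive functions nat^n -> nat: zero, successor and
   projections, closed under composition, primitive recursion and minimization
   of regular functions (those for which a zero always exists).  The function
   obtained by each scheme is given by its defining equations, which determine
   it uniquely.  Membership in this class is a genuine restriction even in the
   presence of classical choice, unlike membership in nat -> bool. *)
Inductive recursive : forall n, (n.-tuple nat -> nat) -> Prop :=
| rec_zero n : recursive (fun _ : n.-tuple nat => 0)
| rec_succ : recursive (fun v : 1.-tuple nat => (thead v).+1)
| rec_proj n (i : 'I_n) : recursive (fun v : n.-tuple nat => tnth v i)
| rec_comp m n (f : m.-tuple nat -> nat) (g : 'I_m -> n.-tuple nat -> nat) :
    recursive f -> (forall i, recursive (g i)) ->
    recursive (fun v : n.-tuple nat => f [tuple g i v | i < m])
| rec_prim n (f : n.-tuple nat -> nat) (g : n.+2.-tuple nat -> nat)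
    (h : n.+1.-tuple nat -> nat) :
    recursive f -> recursive g ->
    (forall v : n.-tuple nat, h [tuple of 0 :: v] = f v) ->
    (forall k (v : n.-tuple nat),
       h [tuple of k.+1 :: v] = g [tuple of k :: h [tuple of k :: v] :: v]) ->
    recursive h
| rec_min n (f : n.+1.-tuple nat -> nat) (h : n.-tuple nat -> nat) :
    recursive f ->
    (forall v : n.-tuple nat, f [tuple of h v :: v] = 0) ->
    (forall (v : n.-tuple nat) k,
       k < h v -> f [tuple of k :: v] <> 0) ->
    recursive h.

Section Words.
Variable A : finType.

(* (x, false) stands for x and (x, true) for the formal inverse of x. *)
Definition letter := (A * bool)%type.
Definition word := seq letter.

Definition pos (x : A) : letter := (x, false).
Definition neg (x : A) : letter := (x, true).
Definition linv (l : letter) : letter := (l.1, ~~ l.2).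
Definition winv (w : word) : word := rev (map linv w).

(* Bijective base-#|letter| numeration; letters are numbered from 1. *)
Fixpoint code (w : word) : nat :=
  if w is l :: w' then #|{: letter}| * code w' + (enum_rank l).+1 else 0.

Definition decidable_language (L : set word) : Prop :=
  exists2 f : 1.-tuple nat -> nat,
    recursive f & forall w, f [tuple code w] = nat_of_bool `[< L w >].

Section InGroup.
Variables (G : groupType) (gen : A -> G).
Local Open Scope group_scope.

Definition letter_val (l : letter) : G :=
  if l.2 then (gen l.1)^-1 else gen l.1.
Definition word_val (w : word) : G := \prod_(l <- w) letter_val l.

Definition membership_decidable (M : set G) : Prop :=
  decidable_language [set w | M (word_val w)]%classic.

End InGroup.

End Words.

Definition is_submonoid (G : groupType) (M : set G) : Prop :=
  M 1%g /\ forall x y, M x -> M y -> M (x * y)%g.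

Definition submonoid_generated (G : groupType) (X : set G) : set G :=
  smallest (@is_submonoid G) X.

Section OneRelator.
Variables (A : finType) (r : word A).

(* Equality of words in <A | r = 1>: the monoid congruence generated by free
   cancellation and r = 1. *)
Inductive weq : word A -> word A -> Prop :=
| weq_refl u : weq u u
| weq_sym u v : weq u v -> weq v u
| weq_trans u v w : weq u v -> weq v w -> weq u w
| weq_cat u u' v v' : weq u u' -> weq v v' -> weq (u ++ v) (u' ++ v')
| weq_cancel l : weq [:: l; linv l] [::]
| weq_relator : weq r [::].

Definition weqb (u v : word A) : bool := `[< weq u v >].

Lemma weqb_equiv : equiv_class_of weqb.
Proof.
split=> [u|u v|v u w] /=; first exact/asboolP/weq_refl.
  by apply/asboolP/asboolP; exact: weq_sym.
by move=> /asboolP uv /asboolP vw; apply/asboolP/(weq_trans uv).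
Qed.

Canonical weqb_equivRel := EquivRelPack weqb_equiv.

Definition one_relator := {eq_quot weqb}%qT.
HB.instance Definition _ := Choice.on one_relator.

Definition class (w : word A) : one_relator := (\pi_(one_relator) w)%qT.
Definition rep (g : one_relator) : word A := repr g.

Lemma classP u v : class u = class v <-> weq u v.
Proof.
split=> [/eqP|uv]; first by rewrite /class eqquotE => /asboolP.
by apply/eqP; rewrite /class eqquotE; apply/asboolP.
Qed.

Lemma repK g : class (rep g) = g.
Proof. exact: reprK. Qed.

Lemma linvK : involutive (@linv A).
Proof. by case=> x b; rewrite /linv /= negbK. Qed.

Lemma winvK : involutive (@winv A).
Proof. move=> w; rewrite /winv map_rev revK -map_comp map_id_in // => l _.
exact: linvK. Qed.

Lemma weq_mulV w : weq (w ++ winv w) [::].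
Proof.
elim: w => [|l w IH]; first exact: weq_refl.
have -> : (l :: w) ++ winv (l :: w) = [:: l] ++ (w ++ winv w) ++ [:: linv l].
  by rewrite /winv /= rev_cons -cats1 catA.
apply: (weq_trans (v := [:: l] ++ [::] ++ [:: linv l])); last exact: weq_cancel.
by apply: weq_cat; [exact: weq_refl | apply: weq_cat => //; exact: weq_refl].
Qed.

Lemma weq_Vmul w : weq (winv w ++ w) [::].
Proof. by have := weq_mulV (winv w); rewrite winvK. Qed.

Lemma weq_inv u v : weq u v -> weq (winv u) (winv v).
Proof.
move=> uv; apply: (weq_trans (v := winv u ++ (v ++ winv v))).
  rewrite -{1}[winv u]cats0; apply: weq_cat; first exact: weq_refl.
  exact/weq_sym/weq_mulV.
apply: (weq_trans (v := (winv u ++ u) ++ winv v)).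
  rewrite -catA; apply: weq_cat; first exact: weq_refl.
  by apply: weq_cat; [exact: weq_sym | exact: weq_refl].
rewrite -[winv v in X in weq _ X]cat0s.
by apply: weq_cat; [exact: weq_Vmul | exact: weq_refl].
Qed.

Definition or_one : one_relator := class [::].
Definition or_mul (x y : one_relator) : one_relator := class (rep x ++ rep y).
Definition or_inv (x : one_relator) : one_relator := class (winv (rep x)).

Lemma weq_rep u : weq (rep (class u)) u.
Proof. by apply/classP; rewrite repK. Qed.

Lemma class_cat u v : class (u ++ v) = or_mul (class u) (class v).
Proof. by apply/classP/weq_sym/weq_cat; exact: weq_rep. Qed.

Lemma class_inv u : class (winv u) = or_inv (class u).
Proof. by apply/classP/weq_sym/weq_inv; exact: weq_rep. Qed.

Lemma or_mulA : associative or_mul.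
Proof.
by move=> x y z; rewrite -(repK x) -(repK y) -(repK z) -!class_cat catA.
Qed.

Lemma or_mul1 : left_id or_one or_mul.
Proof. by move=> x; rewrite -(repK x) -class_cat. Qed.

Lemma or_mulr1 : right_id or_one or_mul.
Proof. by move=> x; rewrite -(repK x) -class_cat cats0. Qed.

Lemma or_mulV : left_inverse or_one or_inv or_mul.
Proof.
move=> x; rewrite -(repK x) -class_inv -class_cat.
exact/classP/weq_Vmul.
Qed.

Lemma or_mulrV : right_inverse or_one or_inv or_mul.
Proof.
move=> x; rewrite -(repK x) -class_inv -class_cat.
exact/classP/weq_mulV.
Qed.

HB.instance Definition _ :=
  isGroup.Build one_relator or_mulA or_mul1 or_mulr1 or_mulV or_mulrV.

Definition or_gen (x : A) : one_relator := class [:: pos x].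

Lemma word_val_class w : word_val or_gen w = class w.
Proof.
elim: w => [|l w IH]; first by rewrite /word_val big_nil.
rewrite /word_val big_cons -/(word_val or_gen w) IH -cat1s class_cat.
congr (_ * _)%g; case: l => x [] //=.
exact/esym/(class_inv [:: pos x]).
Qed.

Lemma word_valP u v : word_val or_gen u = word_val or_gen v <-> weq u v.
Proof. by rewrite !word_val_class; exact: classP. Qed.

(* The notion presupposes that every letter of A occurs in r.  Strictness is
   that of the set S of formal letters in the alphabet A u A^-1. *)
Definition Magnus_submonoid (M : set one_relator) : Prop :=
  (forall x : A, x \in [seq l.1 | l <- r]) /\
  exists2 S : set (letter A), (S `<` setT)%classic &
    M = submonoid_generated (letter_val or_gen @` S)%classic.

End OneRelator.

Variant generator := gen_a | gen_t.

Definition bool_of_generator (x : generator) : bool :=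
  if x is gen_t then true else false.
Definition generator_of_bool (b : bool) : generator :=
  if b then gen_t else gen_a.
Lemma bool_of_generatorK : cancel bool_of_generator generator_of_bool.
Proof. by case. Qed.

HB.instance Definition _ :=
  Finite.copy generator (can_type bool_of_generatorK).

Definition t_word : word generator := [:: pos gen_t].
Definition ata_word : word generator := [:: pos gen_a; pos gen_t; neg gen_a].

(* t (a t a^-1) ((a t a^-1) t)^-1 *)
Definition relator : word generator :=
  t_word ++ ata_word ++ winv (ata_word ++ t_word).

Lemma relator_full (x : generator) : x \in [seq l.1 | l <- relator].
Proof. by case: x. Qed.

(* Main.v *)
Require Import Defs.
From HB Require Import structures.
From mathcomp Require Import all_boot.
From mathcomp Require Import boolp classical_sets.
From mathcomp Require Import order ssralg ssrnum ssrint zify.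

(** The idea.  Put s = a t a^-1.  The group is the HNN extension of the free
abelian group <t, s> in which the stable letter a carries t to s, so every
element has a unique normal form (Britton), computed by reading a word from
left to right ([nf], [nfP]).  This decides equality of words, and membership
in a submonoid generated by letters becomes a search for a word over these
letters with a given normal form.  The search is finite because of a length
bound, [size_Magnus_word]: a freely reduced word u that avoids one of the four
letters, and equals a word w of length n in the group, has length at most
n + 2n(n+1).

For the bound, consider the exponent sum of a letter in a word, and, for each
integer i, the exponent sum of those letters t that stand at level i, i.e.
after a prefix whose exponent sum in a is i.  These are invariants of the
group element, since they record its image in the wreath product Z wr Z, where
t and its conjugate by a commute; for w they are at most n in absolute value,
and no level of absolute value above n carries a nonzero sum.  Let x be a
generator that occurs in u with a single sign, and y the other one.  Then x
occurs at most n times, and u consists of these occurrences, separated by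
blocks of the form y^k, whose lengths are to be bounded.  If x is a, the
successive blocks lie at distinct levels, so k is the exponent sum of t at the
level of its block ([a_block_bound]).  If x is t, there is no cancellation
between the letters t on one level, so that each block of letters a joins two
levels which carry a nonzero sum or are the initial or final level
([t_block_bound]).

On the side of computability, the class of recursive functions is shown to
contain a pairing function with its projections, iteration and bounded
search, which suffices to compute normal forms on codes ([code_runE],
[rec1_code_run]) and to carry out the search ([rtest_search]). *)

Set Implicit Arguments.
Unset Strict Implicit.
Unset Printing Implicit Defensive.

Import Order.TTheory GRing.Theory.
Local Open Scope nat_scope.

(** * Recursive functions of one variable *)

(** The unary functions of the class are closed under composition, pairing and
iteration; several variables are only used to construct the arithmetic
operations, after which arguments are carried along by pairing. *)
Definition rec1 (f : nat -> nat) := recursive (fun v : 1.-tuple nat => f (thead v)).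

Definition rec2 (f : nat -> nat -> nat) :=
  recursive (fun v : 2.-tuple nat => f (tnth v ord0) (tnth v ord_max)).

Lemma recursive_eq n (f g : n.-tuple nat -> nat) :
  recursive f -> f =1 g -> recursive g.
Proof. by move=> rf /funext <-. Qed.

Lemma rec1_app f : rec1 f -> forall n (g : n.-tuple nat -> nat), recursive g ->
  recursive (fun v => f (g v)).
Proof.
move=> rf n g rg; apply: (recursive_eq (rec_comp (g := fun=> g) rf (fun=> rg))).
by move=> v; rewrite /thead tnth_mktuple.
Qed.

Lemma rec2_app f : rec2 f -> forall n (g h : n.-tuple nat -> nat),
  recursive g -> recursive h -> recursive (fun v => f (g v) (h v)).
Proof.
move=> rf n g h rg rh.
pose k (i : 'I_2) := if i == ord0 then g else h.
have rk i : recursive (k i) by rewrite /k; case: ifP.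
apply: (recursive_eq (rec_comp rf rk)).
by move=> v; rewrite !tnth_mktuple.
Qed.

Lemma recursive_cst n c : recursive (fun _ : n.-tuple nat => c).
Proof.
elim: c => [|c IH]; first exact: rec_zero.
exact: (@rec1_app succn rec_succ _ (fun=> c)).
Qed.

Lemma rec1_id : rec1 id. Proof. exact: rec_proj. Qed.
Lemma rec1_cst c : rec1 (fun=> c). Proof. exact: recursive_cst. Qed.
Lemma rec1_comp f g : rec1 f -> rec1 g -> rec1 (fun x => f (g x)).
Proof. by move=> rf rg; exact: (rec1_app rf rg). Qed.
Lemma rec2_comp f g h : rec2 f -> rec1 g -> rec1 h -> rec1 (fun x => f (g x) (h x)).
Proof. by move=> rf rg rh; exact: (rec2_app rf rg rh). Qed.
Lemma rec1_succ : rec1 succn. Proof. exact: rec_succ. Qed.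
Lemma rec1S f : rec1 f -> rec1 (fun x => (f x).+1).
Proof. by move=> rf; exact: (rec1_app rec_succ). Qed.
Lemma rec2_swap f : rec2 f -> rec2 (fun x y => f y x).
Proof. by move=> rf; apply: (rec2_app rf); exact: rec_proj. Qed.

Lemma rec2_fst f : rec1 f -> rec2 (fun x _ => f x).
Proof. by move=> rf; apply: (rec1_app rf); exact: rec_proj. Qed.
Lemma rec2_snd f : rec1 f -> rec2 (fun _ y => f y).
Proof. by move=> rf; apply: (rec1_app rf); exact: rec_proj. Qed.
Lemma rec2_app2 f g h : rec2 f -> rec2 g -> rec2 h ->
  rec2 (fun x y => f (g x y) (h x y)).
Proof. by move=> rf rg rh; exact: (rec2_app rf rg rh). Qed.

Lemma rec2_prim (f : nat -> nat) (g : nat -> nat -> nat) (h : nat -> nat -> nat) :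
  rec1 f -> rec2 g -> (forall x, h 0 x = f x) ->
  (forall k x, h k.+1 x = g (h k x) x) -> rec2 h.
Proof.
move=> rf rg h0 hS.
have rg' : recursive (fun v : 3.-tuple nat =>
    g (tnth v (inord 1)) (tnth v (inord 2))).
  by apply: (rec2_app rg); exact: rec_proj.
have nth1 k (v : 1.-tuple nat) : tnth [tuple of k :: v] ord_max = thead v.
  by rewrite /thead !(tnth_nth 0).
apply: rec_prim rf rg' _ _ => [v|k v]; rewrite !nth1.
  exact: h0.
rewrite [LHS]hS; congr (g _ _).
by rewrite (tnth_nth 0) inordK.
by rewrite (tnth_nth 0) inordK // /thead (tnth_nth 0).
Qed.

Lemma rec1_iter k a f : rec1 k -> rec1 a -> rec1 f ->
  rec1 (fun x => iter (k x) f (a x)).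
Proof.
move=> rk ra rf; apply: (@rec2_comp (fun k x => iter k f x)) => //.
exact: (@rec2_prim id (fun y _ => f y) _ rec1_id (rec2_fst rf)).
Qed.

Lemma rec2_add : rec2 addn.
Proof. exact: (@rec2_prim id (fun x _ => x.+1) _ rec1_id (rec2_fst rec_succ)). Qed.

Lemma rec2_mul : rec2 muln.
Proof.
by apply: (@rec2_prim (fun=> 0) (fun x y => y + x) _ (rec1_cst 0)
  (rec2_swap rec2_add)) => *; rewrite // mulSn.
Qed.

Lemma rec1_pred f : rec1 f -> rec1 (fun x => (f x).-1).
Proof.
move=> rf.
suff rp : rec2 (fun x _ => x.-1) by exact: (rec2_comp rp rf rf).
have rk : recursive (fun v : 3.-tuple nat => tnth v ord0) by exact: rec_proj.
by apply: (rec_prim (recursive_cst 1 0) rk).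
Qed.

Lemma rec2_sub : rec2 subn.
Proof.
apply: (@rec2_swap (fun k x => x - k)).
apply: (@rec2_prim id (fun x _ => x.-1)) => [||x|k x].
- exact: rec1_id.
- exact: rec2_fst (rec1_pred rec1_id).
- exact: subn0.
- exact: subnS.
Qed.

Lemma rec1D f g : rec1 f -> rec1 g -> rec1 (fun x => f x + g x).
Proof. exact: rec2_comp rec2_add. Qed.
Lemma rec1M f g : rec1 f -> rec1 g -> rec1 (fun x => f x * g x).
Proof. exact: rec2_comp rec2_mul. Qed.
Lemma rec1B f g : rec1 f -> rec1 g -> rec1 (fun x => f x - g x).
Proof. exact: rec2_comp rec2_sub. Qed.

(** Used to invert explicit monotone functions: quotients and integer square
roots are least solutions of an inequality. *)
Lemma rec1_min (f : nat -> nat -> nat) h : rec2 f ->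
  (forall x, f (h x) x = 0) -> (forall x k, k < h x -> f k x <> 0) -> rec1 h.
Proof.
move=> rf h0 hmin; apply: rec_min rf _ _ => [v|v k /hmin];
  by rewrite !(tnth_nth 0) /= -?(tnth_nth 0 v ord0).
Qed.

Definition rtest (c : nat -> bool) := rec1 (fun x => c x).

Lemma rec1_if c f g : rtest c -> rec1 f -> rec1 g ->
  rec1 (fun x => if c x then f x else g x).
Proof.
move=> rc rf rg.
apply: (recursive_eq (rec1D (rec1M rc rf) (rec1M (rec1B (rec1_cst 1) rc) rg))).
by move=> v /=; case: (c _); rewrite ?mul0n ?mul1n ?addn0.
Qed.

Lemma rtest_le f g : rec1 f -> rec1 g -> rtest (fun x => f x <= g x).
Proof.
move=> rf rg; apply: (recursive_eq (rec1B (rec1_cst 1) (rec1B rf rg))).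
by move=> v; rewrite /leq; case: (f _ - g _).
Qed.

Lemma rtest_and c d : rtest c -> rtest d -> rtest (fun x => c x && d x).
Proof. by move=> rc rd; apply: (recursive_eq (rec1M rc rd)) => v; rewrite mulnb. Qed.

Lemma rtest_eq f g : rec1 f -> rec1 g -> rtest (fun x => f x == g x).
Proof.
move=> rf rg; apply: (recursive_eq (rtest_and (rtest_le rf rg) (rtest_le rg rf))).
by move=> v; rewrite -eqn_leq.
Qed.

Lemma rec1_divn K f : 0 < K -> rec1 f -> rec1 (fun x => f x %/ K).
Proof.
move=> K0 rf; apply: (rec1_comp (f := fun x => x %/ K) _ rf).
apply: (@rec1_min (fun k x => x.+1 - k.+1 * K)).
- exact: (rec2_app2 rec2_sub (rec2_snd rec1_succ)
    (rec2_fst (rec1M rec1_succ (rec1_cst K)))).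
- by move=> x; apply/eqP; rewrite subn_eq0 ltn_ceil.
- by move=> x k; rewrite leq_divRL // => kx; apply/eqP; rewrite subn_eq0 -ltnNge ltnS.
Qed.

Lemma rec1_modn K f : 0 < K -> rec1 f -> rec1 (fun x => f x %% K).
Proof.
move=> K0 rf; apply: (rec1_comp (f := fun x => x %% K) _ rf).
apply: (recursive_eq (rec1B rec1_id (rec1M (rec1_divn K0 rec1_id) (rec1_cst K)))) => v.
by rewrite {1}(divn_eq (thead v) K) addKn.
Qed.

Lemma sqrt_ex n : exists k, n < k.+1 ^ 2.
Proof. by exists n; rewrite expnS expn1; nia. Qed.

Definition isqrt n := ex_minn (sqrt_ex n).

Lemma rec1_sqrt : rec1 isqrt.
Proof.
apply: (@rec1_min (fun k x => x.+1 - k.+1 * k.+1)).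
- exact: (rec2_app2 rec2_sub (rec2_snd rec1_succ)
    (rec2_fst (rec1M rec1_succ rec1_succ))).
- by move=> x; rewrite /isqrt; case: ex_minnP => k; rewrite expnS expn1; lia.
- by move=> x k; rewrite /isqrt; case: ex_minnP => m _ /(_ k); rewrite expnS expn1; lia.
Qed.

(** As (x + y)^2 <= (x + y)^2 + x < (x + y + 1)^2, the square root of the pair
recovers x + y, hence x and y. *)
Definition npair x y := (x + y) * (x + y) + x.
Definition nfst n := n - isqrt n * isqrt n.
Definition nsnd n := isqrt n - nfst n.

Lemma isqrt_npair x y : isqrt (npair x y) = x + y.
Proof.
rewrite /isqrt /npair; case: ex_minnP => m.
by rewrite expnS expn1 => le_m /(_ (x + y)); rewrite expnS expn1; nia.
Qed.
Lemma npairK1 x y : nfst (npair x y) = x.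
Proof. by rewrite /nfst isqrt_npair /npair addKn. Qed.
Lemma npairK2 x y : nsnd (npair x y) = y.
Proof. by rewrite /nsnd npairK1 isqrt_npair addKn. Qed.

Lemma rec2_npair : rec2 npair.
Proof.
exact: (rec2_app2 rec2_add (rec2_app2 rec2_mul rec2_add rec2_add)
  (rec2_fst rec1_id)).
Qed.
Lemma rec1_npair f g : rec1 f -> rec1 g -> rec1 (fun x => npair (f x) (g x)).
Proof. exact: rec2_comp rec2_npair. Qed.
Lemma rec1_nfst f : rec1 f -> rec1 (fun x => nfst (f x)).
Proof.
apply: rec1_comp.
exact: (rec1B rec1_id (rec1M rec1_sqrt rec1_sqrt)).
Qed.
Lemma rec1_nsnd f : rec1 f -> rec1 (fun x => nsnd (f x)).
Proof.
apply: rec1_comp.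
exact: (rec1B rec1_sqrt (rec1_nfst rec1_id)).
Qed.

Lemma rec2_uncurry f : rec1 (fun z => f (nfst z) (nsnd z)) -> rec2 f.
Proof.
move=> rf; apply: (recursive_eq (rec1_app rf (rec2_npair))).
by move=> v; rewrite npairK1 npairK2.
Qed.

(** The least k at which the search succeeds or the bound is reached always
exists, so a regular minimization finds it; it only remains to test it. *)
Lemma rtest_search (p q B : nat -> nat) : rec1 p -> rec1 q -> rec1 B ->
  rtest (fun x => `[< exists2 k, k <= B x & p k = q x >]).
Proof.
move=> rp rq rB.
pose c x k := (B x <= k) || (p k == q x).
have exc x : exists k, c x k by exists (B x); rewrite /c leqnn.
pose h x := ex_minn (exc x).
have rh : rec1 h.
  apply: (@rec1_min (fun k x => ~~ c x k)).
  - apply: rec2_uncurry.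
    have r1 := rtest_le (rec1_comp rB (rec1_nsnd rec1_id)) (rec1_nfst rec1_id).
    have r2 := rtest_eq (rec1_comp rp (rec1_nfst rec1_id))
                        (rec1_comp rq (rec1_nsnd rec1_id)).
    have rN (d : nat -> bool) (rd : rtest d) := rec1B (rec1_cst 1) rd.
    apply: (recursive_eq (rec1M (rN _ r1) (rN _ r2))).
    by move=> v /=; rewrite /c; case: leqP; case: eqP.
  - by move=> x; rewrite /h; case: ex_minnP => k ->.
  - move=> x k; rewrite /h; case: ex_minnP => m _ mmin km.
    by case: (boolP (c x k)) => // /mmin; rewrite leqNgt km.
apply: (recursive_eq (rtest_eq (rec1_comp rp rh) rq)) => v /=.
congr nat_of_bool; apply/eqP/asboolP => [ph|].
  exists (h (thead v)) => //.
  by rewrite /h; case: ex_minnP => m _ -> //; rewrite /c leqnn.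
case=> k kB pk; rewrite /h; case: ex_minnP => m /orP [Bm|/eqP //] mmin.
have /mmin mk : c (thead v) k by rewrite /c pk eqxx orbT.
by have <- : k = m by lia.
Qed.

(** * Normal forms in an HNN extension of Z^2 *)

Section IntegerPowers.
Variable H : groupType.
Local Open Scope group_scope.

Definition zexp (x : H) (k : int) : H :=
  match k with Posz n => x ^+ n | Negz n => x ^- n.+1 end.

Lemma zexpS x k : zexp x (k + 1)%R = zexp x k * x.
Proof.
case: k => n; first by rewrite addrC /= expgSr.
case: n => [|n]; first by rewrite /= expg1 mulVg.
have -> : (Negz n.+1 + 1)%R = Negz n by lia.
by rewrite /= [x ^+ n.+2]expgS invgM mulgVK.
Qed.

Lemma zexpP x k : zexp x (k - 1)%R = zexp x k * x^-1.
Proof. by rewrite -[in RHS](subrK 1%R k) zexpS mulgK. Qed.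

Lemma commute_zexp x y m : commute x y -> commute x (zexp y m).
Proof.
move=> xy; case: m => n; first exact: commuteX.
by apply: commuteV; exact: commuteX.
Qed.

Lemma zexpJ x y m : zexp x m ^ y = zexp (x ^ y) m.
Proof. by case: m => n; rewrite /= ?conjVg conjXg. Qed.

End IntegerPowers.

(** The stack (b_1, j_1) :: (b_2, j_2) :: ... stands for the product
... g_2 g_1, where g_i is t^j_i a if b_i is false and s^j_i a^-1 if b_i is
true; the pair of integers m, n in a normal form stands for the final factor
t^m s^n.  The letters come last-first because words are read from the left. *)
Definition stack := seq (bool * int).
Definition nform : Type := int * int * stack.

(** Multiplication on the right by a letter: t^m s^n a = t^m a t^n and
t^m s^n a^-1 = s^n a^-1 s^m, where the coset representative t^m or s^n goes
onto the stack, unless it is trivial and the stack ends in the inverse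
letter. *)
Definition step (l : letter generator) (x : nform) : nform :=
  let: ((m, n), R) := x in
  match l with
  | (gen_t, b) => ((if b then (m - 1)%R else (m + 1)%R, n), R)
  | (gen_a, false) =>
      if m == 0%R then
        if R is (true, j) :: R' then ((n, j), R')
        else ((n, 0%R), (false, m) :: R)
      else ((n, 0%R), (false, m) :: R)
  | (gen_a, true) =>
      if n == 0%R then
        if R is (false, j) :: R' then ((j, m), R')
        else ((0%R, m), (true, n) :: R)
      else ((0%R, m), (true, n) :: R)
  end.

Definition nf0 : nform := ((0%R, 0%R), [::]).

Definition run (x : nform) (w : word generator) : nform :=
  foldl (fun x l => step l x) x w.
Definition nf (w : word generator) := run nf0 w.

Lemma run_cat x u v : run x (u ++ v) = run (run x u) v.
Proof. exact: foldl_cat. Qed.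

(** Britton's condition: no subword a 1 a^-1 or a^-1 1 a remains. *)
Fixpoint stack_ok (R : stack) : bool :=
  if R is (b, j) :: R' then
    (if R' is (b', _) :: _ then (j == 0%R) ==> (b == b') else true) && stack_ok R'
  else true.

Lemma step_ok l x : stack_ok x.2 -> stack_ok (step l x).2.
Proof.
case: l x => [[] b] [[m n] R] //=.
case: b; (case: eqP => [-> | /eqP/negPf h]);
  case: R => [|[[] j] R] //=; rewrite ?h //=.
all: by case/andP.
Qed.

Lemma run_ok w x : stack_ok x.2 -> stack_ok (run x w).2.
Proof. elim: w x => //= l w IH x ok; apply: IH; exact: step_ok. Qed.

(** On reduced stacks the letters act by permutations; the condition on the
stack ensures that undoing a cancellation pushes back what was removed. *)
Lemma stepK l x : stack_ok x.2 -> step (linv l) (step l x) = x.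
Proof.
case: l x => [[] b] [[m n] R] /=; last first.
  by case: b => /= _; rewrite ?subrK ?addrK.
case: b; (have [-> | /negPf h] /= := eqVneq _ 0%R);
  case: R => [|[[] j] [|[[] j'] R]] //=; rewrite ?h ?eqxx //=;
  by case: eqP => // ->.
Qed.

(** The conjugate s of t acts on the second exponent alone, so it commutes
with t. *)
Lemma run_ata (b : bool) m n R : stack_ok R ->
  run ((m, n), R) [:: pos gen_a; (gen_t, b); neg gen_a] =
    ((m, (if b then n - 1 else n + 1)%R), R).
Proof.
rewrite /run /= => okR; have [-> | /negPf h] := eqVneq m 0%R;
  case: R okR => [|[[] j] [|[[] j'] R]] //=; rewrite ?h ?eqxx //=;
  by case: eqP => // ->.
Qed.

Lemma run_t (b : bool) m n R :
  run ((m, n), R) [:: (gen_t, b)] = (((if b then m - 1 else m + 1)%R, n), R).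
Proof. by []. Qed.

Lemma weq_run u v : weq relator u v ->
  forall x, stack_ok x.2 -> run x u = run x v.
Proof.
elim=> {u v} //.
- by move=> u v _ IH x ok; rewrite IH.
- by move=> u v w _ IHu _ IHv x ok; rewrite IHu // IHv.
- move=> u u' v v' _ IHu _ IHv x ok; rewrite !run_cat IHu // IHv //.
  exact: run_ok.
- by move=> l x ok; rewrite /run /= stepK.
- move=> [[m n] R] ok.
  have -> : relator =
      [:: (gen_t, false)] ++ [:: pos gen_a; (gen_t, false); neg gen_a] ++
      [:: (gen_t, true)] ++ [:: pos gen_a; (gen_t, true); neg gen_a] by [].
  by rewrite 3!run_cat run_t run_ata // run_t run_ata // !addrK.
Qed.

Section Value.
Local Open Scope group_scope.
Let a : one_relator relator := or_gen relator gen_a.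
Let t : one_relator relator := or_gen relator gen_t.
Let s : one_relator relator := a * t * a^-1.

Fixpoint stack_val (R : stack) : one_relator relator :=
  if R is (b, j) :: R' then
    stack_val R' * (if b then zexp s j * a^-1 else zexp t j * a)
  else 1.

Definition nf_val (x : nform) : one_relator relator :=
  stack_val x.2 * zexp t x.1.1 * zexp s x.1.2.

Lemma commute_ts : commute t s.
Proof.
have rel1 : word_val (or_gen relator) relator = 1.
  by rewrite word_val_class; apply/classP; exact: weq_relator.
apply/eqP; rewrite -(inj_eq (mulIg (s * t)^-1)) mulgV; apply/eqP.
rewrite -[RHS]rel1 /word_val /relator /= !big_cons big_nil /letter_val /=.
by rewrite -/a -/t /s !invgM invgK !mulgA mulg1.
Qed.

Lemma zexp_s j : zexp s j = a * zexp t j * a^-1.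
Proof.
have -> : s = t ^ a^-1 by rewrite /s conjgE invgK !mulgA.
by rewrite -zexpJ conjgE invgK !mulgA.
Qed.

Lemma nf_val_step l x : nf_val (step l x) = nf_val x * letter_val (or_gen relator) l.
Proof.
have cts i j : zexp t i * zexp s j = zexp s j * zexp t i.
  by apply/commute_zexp/commute_sym/commute_zexp/commute_sym/commute_ts.
have sa k : zexp s k * a = a * zexp t k by rewrite zexp_s mulgVK.
have ta k : zexp t k * a^-1 = a^-1 * zexp s k by rewrite zexp_s !mulgA mulVg mul1g.
have st k : t * zexp s k = zexp s k * t by have := cts 1%R k; rewrite /= expg1.
have stV k : t^-1 * zexp s k = zexp s k * t^-1.
  by apply: (mulgI t); rewrite mulVKg mulgA st mulgK.
case: l x => [[] b] [[m n] R]; rewrite /letter_val /nf_val /=; last first.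
  rewrite -/t -!mulgA; congr (_ * _).
  by case: b; rewrite ?(zexpP, zexpS) -mulgA (st, stV).
rewrite -/a; case: b; (have [-> | _] /= := eqVneq _ 0%R; last 1 first).
- by rewrite mulg1 -!mulgA -ta (mulgA (zexp s n)) -cts !mulgA.
- case: R => [|[[] j] R] /=; rewrite ?mulg1 ?mul1g -?mulgA ?ta ?mulVKg //.
- by rewrite mulg1 -!mulgA sa.
- case: R => [|[[] j] R] /=; rewrite ?mulg1 ?mul1g -?mulgA ?sa ?mulKg //.
  by rewrite cts.
Qed.

Lemma nf_val_run x w : nf_val (run x w) = nf_val x * class relator w.
Proof.
rewrite -word_val_class /word_val.
elim: w x => [|l w IH] x; first by rewrite big_nil mulg1.
by rewrite big_cons mulgA -nf_val_step -IH.
Qed.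

(** The group acts on reduced normal forms, so equal words have the same one;
conversely a normal form determines its value. *)
Lemma nfP u v : nf u = nf v <-> weq relator u v.
Proof.
split=> [|/weq_run]; last by apply.
move/(congr1 nf_val); rewrite !nf_val_run /nf_val /= !mul1g.
by move/classP.
Qed.

End Value.

(** * Normal forms computed on codes *)

(** The two components are the positive and negative parts, so that successor,
predecessor and the test for 0 are immediate. *)
Definition code_int (k : int) : nat :=
  match k with Posz n => npair n 0 | Negz n => npair 0 n.+1 end.

Fixpoint code_stack (R : stack) : nat :=
  if R is (b, j) :: R' then
    (npair b (npair (code_int j) (code_stack R'))).+1
  else 0.

Definition code_nf (x : nform) : nat :=
  let: ((m, n), R) := x in
  npair (code_int m) (npair (code_int n) (code_stack R)).

Lemma npair_inj x y x' y' : npair x y = npair x' y' -> x = x' /\ y = y'.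
Proof.
move=> e; split; first by rewrite -(npairK1 x y) e npairK1.
by rewrite -(npairK2 x y) e npairK2.
Qed.

Lemma code_int_inj : injective code_int.
Proof. by case=> m [] n /npair_inj [] // e e'; congr _; lia. Qed.

Lemma code_stack_inj : injective code_stack.
Proof.
elim=> [|[b j] R IH] [|[b' j'] R'] //= [] /npair_inj[bb] /npair_inj[/code_int_inj -> /IH ->].
by case: b b' bb => [] [].
Qed.

Lemma code_nf_inj : injective code_nf.
Proof.
move=> [[m n] R] [[m' n'] R'] /npair_inj[/code_int_inj ->].
by case/npair_inj => /code_int_inj -> /code_stack_inj ->.
Qed.

Definition code_succ z := if nsnd z == 0 then npair (nfst z).+1 0 else npair 0 (nsnd z).-1.
Definition code_pred z := if nfst z == 0 then npair 0 (nsnd z).+1 else npair (nfst z).-1 0.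

Lemma code_succE k : code_succ (code_int k) = code_int (k + 1)%R.
Proof.
case: k => n; rewrite /code_succ npairK2 ?npairK1; first by rewrite -PoszD addn1.
case: n => [|n] //; have -> // : (Negz n.+1 + 1)%R = Negz n by lia.
Qed.

Lemma code_predE k : code_pred (code_int k) = code_int (k - 1)%R.
Proof.
case: k => n; rewrite /code_pred ?npairK2 npairK1; last first.
  by have -> : (Negz n - 1)%R = Negz n.+1 by lia.
by case: n => [|n] //; have -> : (Posz n.+1 - 1)%R = Posz n by lia.
Qed.

(** Here R = 0 is the empty stack; otherwise R.-1 unpacks into the top entry,
whose sign is 1 for a^-1 and 0 for a, and the rest R'. *)
Definition code_step (l : letter generator) (c : nat) : nat :=
  let m := nfst c in let n := nfst (nsnd c) in let R := nsnd (nsnd c) in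
  let j := nfst (nsnd R.-1) in let R' := nsnd (nsnd R.-1) in
  match l with
  | (gen_t, false) => npair (code_succ m) (npair n R)
  | (gen_t, true) => npair (code_pred m) (npair n R)
  | (gen_a, false) =>
      if (m == 0) && ((1 <= R) && (nfst R.-1 == 1)) then npair n (npair j R')
      else npair n (npair 0 (npair 0 (npair m R)).+1)
  | (gen_a, true) =>
      if (n == 0) && ((1 <= R) && (nfst R.-1 == 0)) then npair j (npair m R')
      else npair 0 (npair m (npair 1 (npair n R)).+1)
  end.

Lemma code_int_eq0 k : (code_int k == 0) = (k == 0%R).
Proof. exact: (inj_eq code_int_inj k 0%R). Qed.

Lemma code_stepE l x : code_step l (code_nf x) = code_nf (step l x).
Proof.
case: x => [[m n] R]; case: l => [[] []]; rewrite /code_step /= !npairK2 !npairK1 ?code_int_eq0 ?code_succE ?code_predE //.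
all: case: eqP => //= _; case: R => [|[[] j] R] //=; rewrite !(npairK1, npairK2) //.
Qed.

Lemma rec1_code_step l f : rec1 f -> rec1 (fun x => code_step l (f x)).
Proof.
apply: rec1_comp.
have r_m := rec1_nfst rec1_id; have r_s := rec1_nsnd rec1_id.
have r_n := rec1_nfst r_s; have r_R := rec1_nsnd r_s.
have r_top := rec1_pred r_R.
have r_b := rec1_nfst r_top; have r_t := rec1_nsnd r_top.
have r_j := rec1_nfst r_t; have r_R' := rec1_nsnd r_t.
have c0 := rec1_cst 0; have c1 := rec1_cst 1.
have r_succ : rec1 code_succ.
  exact: (rec1_if (rtest_eq r_s c0) (rec1_npair (rec1S r_m) c0)
    (rec1_npair c0 (rec1_pred r_s))).
have r_pred : rec1 code_pred.
  exact: (rec1_if (rtest_eq r_m c0) (rec1_npair c0 (rec1S r_s))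
    (rec1_npair (rec1_pred r_m) c0)).
case: l => [[] []].
- exact: (rec1_if (rtest_and (rtest_eq r_n c0) (rtest_and (rtest_le c1 r_R) (rtest_eq r_b c0)))
    (rec1_npair r_j (rec1_npair r_m r_R'))
    (rec1_npair c0 (rec1_npair r_m (rec1S (rec1_npair c1 (rec1_npair r_n r_R)))))).
- exact: (rec1_if (rtest_and (rtest_eq r_m c0) (rtest_and (rtest_le c1 r_R) (rtest_eq r_b c1)))
    (rec1_npair r_n (rec1_npair r_j r_R'))
    (rec1_npair r_n (rec1_npair c0 (rec1S (rec1_npair c0 (rec1_npair r_m r_R)))))).
- exact: (rec1_npair (rec1_comp r_pred r_m) (rec1_npair r_n r_R)).
- exact: (rec1_npair (rec1_comp r_succ r_m) (rec1_npair r_n r_R)).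
Qed.

Section Run.
Variable S : pred (letter generator).

Let K := #|{: letter generator}|.
Let K_gt0 : 0 < K. Proof. by apply/card_gt0P; exists (pos gen_a). Qed.

(** Letters are recognized by their rank in the code of a word, and those
outside S are skipped: the values of the resulting computation on all numbers
are then exactly the normal forms of the words over S. *)
Definition digit_step (d c : nat) : nat :=
  foldr (fun l r => if (d == enum_rank l :> nat) && S l then code_step l c else r) c
    (enum {: letter generator}).

Lemma digit_stepE l c :
  digit_step (enum_rank l) c = if S l then code_step l c else c.
Proof.
have eqd k : (nat_of_ord (enum_rank l) == nat_of_ord (enum_rank k)) = (l == k).
  by rewrite (inj_eq val_inj) (inj_eq enum_rank_inj).
rewrite /digit_step; case: ifPn => [Sl|nSl]; last first.
  by elim: (enum _) => //= k e ->; rewrite eqd; case: eqP nSl => // -> /negPf ->.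
have : l \in enum {: letter generator} by rewrite mem_enum.
elim: (enum _) => //= k e IH; rewrite inE eqd.
by case: eqP => [<- _|_ /IH //]; rewrite Sl.
Qed.

(** The state pairs the code of the unread part of the word with the code of
the normal form of the part already read. *)
Definition read_letter z :=
  if nfst z == 0 then z
  else npair ((nfst z).-1 %/ K) (digit_step ((nfst z).-1 %% K) (nsnd z)).

(** A word is no longer than its code, so n iterations read it entirely; the
final 0 codes the trivial normal form. *)
Definition code_run n := nsnd (iter n read_letter (npair n 0)).

Lemma size_le_code (w : word generator) : size w <= code w.
Proof.
elim: w => //= l w IH; rewrite addnS ltnS.
by apply: leq_trans (leq_addr _ _); apply: leq_trans IH (leq_pmull _ _).
Qed.

Lemma read_letterE l w x :
  read_letter (npair (code (l :: w)) (code_nf x)) =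
  npair (code w) (code_nf (if S l then step l x else x)).
Proof.
rewrite /read_letter npairK1 npairK2 /= addnS /= -/K mulnC divnMDl // modnMDl.
rewrite divn_small ?ltn_ord // modn_small ?ltn_ord // addn0 digit_stepE.
by rewrite code_stepE; case: ifP.
Qed.

Lemma iter_read_letter n w x : size w <= n ->
  nsnd (iter n read_letter (npair (code w) (code_nf x))) =
  code_nf (run x (filter S w)).
Proof.
elim: n w x => [|n IH] [|l w] x // le_n; rewrite ?iterSr.
- by rewrite npairK2.
- by rewrite {2}/read_letter npairK1; exact: (IH [::]).
- by rewrite read_letterE IH //=; case: ifP.
Qed.

Lemma code_runE w : code_run (code w) = code_nf (nf (filter S w)).
Proof. exact: (iter_read_letter nf0 (size_le_code w)). Qed.

Lemma rec1_code_run : rec1 code_run.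
Proof.
have rd d c : rec1 d -> rec1 c -> rec1 (fun z => digit_step (d z) (c z)).
  move=> rd rc; rewrite /digit_step; elim: (enum _) => //= l e IH.
  exact: (rec1_if (rtest_and (rtest_eq rd (rec1_cst _)) (rec1_cst (S l)))
    (rec1_code_step l rc) IH).
have rf := rec1_nfst rec1_id; have rp := rec1_pred rf.
have r_drive : rec1 read_letter.
  exact: (rec1_if (rtest_eq rf (rec1_cst 0)) rec1_id
    (rec1_npair (rec1_divn K_gt0 rp)
       (rd _ _ (rec1_modn K_gt0 rp) (rec1_nsnd rec1_id)))).
exact: (rec1_nsnd (rec1_iter rec1_id (rec1_npair rec1_id (rec1_cst 0)) r_drive)).
Qed.

End Run.

(** Whatever number a search finds is thus the code of a word. *)
Lemma code_surj n : exists w : word generator, code w = n.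
Proof.
pose K := #|{: letter generator}|.
have K0 : 0 < K by apply/card_gt0P; exists (pos gen_a).
have [k] := ubnP n; elim: k n => // k IH [|n] lt_n; first by exists [::].
have [w cw] : exists w : word generator, code w = n %/ K.
  by apply: IH; apply: leq_ltn_trans (leq_div _ _) _.
exists (enum_val (Ordinal (ltn_pmod n K0)) :: w).
by rewrite /= cw enum_valK /= addnS mulnC -divn_eq.
Qed.

(** The digits of a code range from 1 to the number of letters, which is one
less than the base of this power. *)
Lemma code_lt (w : word generator) :
  code w < #|{: letter generator}|.+1 ^ size w.
Proof.
elim: w => //= l w IH; rewrite expnS mulSn -[X in X < _]add0n.
apply: (leq_ltn_trans (n := 0 + #|{: letter generator}| * (code w).+1)).
  by rewrite !add0n mulnS [X in _ <= X]addnC leq_add2l ltn_ord.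
by rewrite -addSn leq_add ?expn_gt0 // leq_mul2l IH orbT.
Qed.

(** * Length of the shortest word over a proper set of letters *)

Section Exponents.
Local Open Scope ring_scope.

Definition sgn (b : bool) : int := if b then -1 else 1.

Fixpoint expo (x : generator) (w : word generator) : int :=
  if w is l :: w' then (if l.1 == x then sgn l.2 else 0) + expo x w' else 0.

(** Exponent sum of the letters t at level i, for a word that starts at level
p. *)
Fixpoint level_expo (p i : int) (w : word generator) : int :=
  match w with
  | [::] => 0
  | (gen_a, b) :: w' => level_expo (p + sgn b) i w'
  | (gen_t, b) :: w' => (if p == i then sgn b else 0) + level_expo p i w'
  end.

Lemma expo_cat x u v : expo x (u ++ v) = expo x u + expo x v.
Proof. by elim: u => [|l u IH] /=; rewrite ?add0r // IH addrA. Qed.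

Lemma level_expo_cat p i u v :
  level_expo p i (u ++ v) = level_expo p i u + level_expo (p + expo gen_a u) i v.
Proof.
elim: u p => [|[[] b] u IH] p /=; rewrite ?add0r ?addr0 //.
  by rewrite IH addrA.
by rewrite IH addrA.
Qed.

Lemma weq_expo u v x : weq relator u v -> expo x u = expo x v.
Proof.
elim=> {u v} //.
- by move=> u v w _ -> _ ->.
- by move=> u u' v v' _ IHu _ IHv; rewrite !expo_cat IHu IHv.
- by case=> y [] /=; case: eqP.
- by case: x.
Qed.

Lemma weq_level_expo u v p i : weq relator u v -> level_expo p i u = level_expo p i v.
Proof.
move=> uv; elim: uv p => {u v} //.
- by move=> u v w _ IHu _ IHv p; rewrite IHu.
- by move=> u u' v v' uu IHu _ IHv p; rewrite !level_expo_cat IHu IHv (weq_expo _ uu).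
- by case=> [[] []] p //=; case: eqP.
- by move=> p; rewrite /= /sgn !addrK; case: eqP; case: eqP; lia.
Qed.

Lemma expo_le x w : (`|expo x w| <= size w)%N.
Proof. elim: w => [|[y b] w IH] //=; case: eqP => _; case: b; rewrite /sgn; lia. Qed.

Lemma level_expo_le p i w : (`|level_expo p i w| <= size w)%N.
Proof.
elim: w p => [|[[] b] w IH] p //=.
  by move: (IH (p + sgn b)); lia.
by move: (IH p); case: b; case: eqP => _; rewrite /sgn; lia.
Qed.

Lemma level_expo_support p i w : level_expo p i w != 0 -> (`|i - p| <= size w)%N.
Proof.
elim: w p => [|[[] b] w IH] p //=.
  by move/IH; rewrite /sgn; case: b; lia.
by case: (eqVneq p i) => [->|_]; rewrite ?add0r; [lia | move/IH; lia].
Qed.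

Lemma expo_sgn x s u : (x, ~~ s) \notin u ->
  expo x u = sgn s * (count_mem (x, s) u)%:Z.
Proof.
elim: u => [|[y b] u IH] /=; first by rewrite mulr0.
rewrite inE negb_or => /andP[h /IH ->]; move: h.
rewrite !xpair_eqE [x == y]eq_sym; case: (y == x); rewrite /= ?add0r //.
by case: b; case: (s) => //= _; rewrite /sgn; lia.
Qed.

Lemma level_expo_sgn s p i u : (gen_t, ~~ s) \notin u -> 0 <= sgn s * level_expo p i u.
Proof.
elim: u p => [|[[] b] u IH] p; rewrite ?mulr0 // inE negb_or => /andP[h /IH ge0] //=.
move: h (ge0 p); rewrite xpair_eqE /=.
by case: b; case: (s) => //= _; rewrite /sgn; case: eqP; lia.
Qed.

(** When a occurs with one sign only, the levels are visited monotonically, and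
the visited ones lie between the initial and the final level. *)
Lemma level_expo_monotone s p i u : (gen_a, ~~ s) \notin u -> level_expo p i u != 0 ->
  0 <= sgn s * (i - p) <= sgn s * expo gen_a u.
Proof.
elim: u p => [|[[] b] u IH] p //; rewrite inE negb_or => /andP[h hu] /=.
  move/(IH _ hu); move: h; rewrite xpair_eqE /=.
  by case: b; case: (s) => //= _; rewrite /sgn; lia.
have ge0 : 0 <= sgn s * expo gen_a u.
  by rewrite (expo_sgn hu) mulrA; case: (s); rewrite /sgn; lia.
case: (eqVneq p i) => [->|_]; rewrite !add0r; last exact: IH.
by rewrite subrr mulr0 lexx ge0.
Qed.

End Exponents.

Definition reduced (w : word generator) := sorted (fun l l' => l' != linv l) w.

Lemma reduced_expo x w : reduced w -> all (fun l => l.1 == x) w ->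
  `|expo x w| = size w.
Proof.
case: w => [|l w] //= pw /andP[/eqP lx aw].
have -> : w = nseq (size w) l.
  elim: w l lx pw aw => [|l' w IH] l lx //= /andP[l'l pw] /andP[/eqP l'x aw].
  have ll' : l' = l.
    by move: l'l; case: l l' lx l'x {pw aw IH} => [y []] [z []] /= -> ->; rewrite ?eqxx.
  by rewrite ll' -IH // -ll'.
have -> : expo x (nseq (size w) l) = (sgn l.2 * (size w)%:Z)%R.
  by elim: (size w) => [|n] /=; rewrite ?mulr0 // lx eqxx /sgn => ->; lia.
by rewrite size_nseq lx eqxx /sgn; case: l.2; lia.
Qed.

(** Only cancellations are performed, so no new letter appears. *)
Lemma free_reduction w : exists u,
  [/\ reduced u, weq relator u w & {subset u <= w}].
Proof.
elim: w => [|l w [u [ru uw suw]]]; first by exists [::]; split => //; exact: weq_refl.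
have lu : weq relator (l :: u) (l :: w).
  exact: (weq_cat (weq_refl _ [:: l]) uw).
case: u ru uw suw lu => [|l' u] ru uw suw lu.
  by exists [:: l]; split => // k; rewrite !inE => ->.
have [e|ne] := eqVneq l' (linv l).
  exists u; split.
  - exact: path_sorted ru.
  - apply: weq_trans lu; apply: weq_sym; rewrite e.
    exact: (weq_cat (weq_cancel _ l) (weq_refl _ u)).
  - by move=> k ku; rewrite inE suw ?orbT // inE ku orbT.
exists [:: l, l' & u]; split => //; first by rewrite /reduced /= ne.
by move=> k; rewrite inE => /orP[/eqP ->|/suw kw]; rewrite inE ?eqxx // kw orbT.
Qed.

(** b is a maximal factor of u without the generator of l, when l is the only
letter of u on that generator. *)
Definition block_of (l : letter generator) (u u1 b u2 : word generator) :=
  [/\ u = u1 ++ b ++ u2, l.1 \notin map fst b,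
      u1 = [::] \/ exists v, u1 = rcons v l & u2 = [::] \/ exists v, u2 = l :: v].

(** Each block is a power of y, because u is reduced, and there is one block
more than occurrences of x. *)
Lemma size_le_blocks (x y : generator) s N u : x != y -> reduced u -> (x, ~~ s) \notin u ->
  (forall u1 b u2, block_of (x, s) u u1 b u2 -> `|expo y b| <= N) ->
  size u <= count_mem (x, s) u + N * (count_mem (x, s) u).+1.
Proof.
move=> xy; have [n] := ubnP (size u); elim: n u => // n IH u le_n ru xu Hb.
have all_y (b : word generator) : x \notin map fst b -> all (fun l => l.1 == y) b.
  move=> xb; apply/allP => l lb.
  have : l.1 != x by apply: contraNneq xb => <-; exact: map_f.
  by move: xy; case: (l.1); case: (x); case: (y).
have [xin|xout] := boolP (x \in map fst u); last first.
  have /Hb le_N : block_of (x, s) u [::] u [::] by split; rewrite ?cats0 //; left.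
  have := reduced_expo ru (all_y _ xout); lia.
have [b [u' [eu xb]]] : exists b u' : word generator,
    u = b ++ (x, s) :: u' /\ x \notin map fst b.
  have hx : has (fun l => l.1 == x) u.
    by case/mapP: xin => l lu e; apply/hasP; exists l => //; rewrite e.
  move: xu; case: (split_find hx) => -[_ c] b u' /eqP /= -> nb xu.
  exists b, u'; split; last by apply: contra nb => /mapP[l lb ->]; apply/hasP; exists l.
  rewrite cat_rcons; congr (_ ++ (x, _) :: _).
  by move: xu; rewrite mem_cat mem_rcons inE xpair_eqE eqxx !negb_or; case: c; case: (s).
move: ru xu; rewrite eu => /cat_sorted2[rb /path_sorted ru'].
rewrite mem_cat inE !negb_or => /and3P[_ _ xu'].
have cb : count_mem (x, s) b = 0.
  by apply/count_memPn; apply: contra xb => /(map_f fst).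
have /Hb le_b : block_of (x, s) u [::] b ((x, s) :: u').
  by split=> //; [left | right; exists u'].
have size_b := reduced_expo rb (all_y _ xb).
have /IH : size u' < n.
  rewrite eu size_cat /= addnS ltnS in le_n.
  exact: leq_ltn_trans (leq_addl _ _) le_n.
move/(_ ru' xu') => IHu'.
have {}IHu' : size u' <= count_mem (x, s) u' + N * (count_mem (x, s) u').+1.
  apply: IHu' => u1 b' u2 [eu' xb' e1 e2].
  apply: (Hb (b ++ (x, s) :: u1) b' u2); split=> //.
    by rewrite eu eu' -catA.
  right; case: e1 => [->|[v ->]]; first by exists b; rewrite cats1.
  by exists (b ++ (x, s) :: v); rewrite rcons_cat.
rewrite size_cat count_cat cb [count _ (_ :: _)]/= eqxx /= !mulnS in IHu' *; lia.
Qed.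

(** Letters t of a single sign do not cancel, so a level that carries one of
them has a nonzero exponent sum. *)
Lemma t_level s v1 v2 : (gen_t, ~~ s) \notin v1 ++ v2 ->
  level_expo 0 (expo gen_a v1) (v1 ++ (gen_t, s) :: v2) != 0%R.
Proof.
rewrite mem_cat negb_or => /andP[h1 h2].
rewrite level_expo_cat /= !add0r eqxx.
have := level_expo_sgn 0 (expo gen_a v1) h1.
have := level_expo_sgn (expo gen_a v1) (expo gen_a v1) h2.
rewrite /sgn; case: (s); lia.
Qed.

Lemma level_expo_t_block p b : gen_a \notin map fst b -> level_expo p p b = expo gen_t b.
Proof.
by elim: b => [|[[] c] b IH] //=; rewrite inE negb_or //= => /IH ->; rewrite eqxx.
Qed.

Lemma expo_notin x b : x \notin map fst b -> expo x b = 0%R.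
Proof.
elim: b => [|l b IH] //=; rewrite inE negb_or => /andP[xl /IH ->].
by rewrite eq_sym (negPf xl) addr0.
Qed.

(** The block is the only part of u at its level, so its length is an
invariant of the group element. *)
Lemma a_block_bound s w u u1 b u2 : weq relator u w -> (gen_a, ~~ s) \notin u ->
  block_of (gen_a, s) u u1 b u2 -> `|expo gen_t b| <= size w.
Proof.
move=> uw nu [eu ab e1 e2].
rewrite -(level_expo_t_block (expo gen_a u1) ab).
apply: leq_trans (level_expo_le 0 (expo gen_a u1) w).
rewrite -(weq_level_expo _ _ uw) eu !level_expo_cat add0r (expo_notin ab) addr0.
move: nu; rewrite eu !mem_cat !negb_or => /and3P[n1 _ n2].
have -> : level_expo 0 (expo gen_a u1) u1 = 0%R.
  case: e1 n1 => [-> //|[v ->]]; rewrite mem_rcons inE negb_or => /andP[_ nv].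
  rewrite -cats1 level_expo_cat /= !addr0; apply/eqP; apply: contraTT isT => /(level_expo_monotone nv).
  rewrite expo_cat /= /sgn; case: (s); lia.
have -> : level_expo (expo gen_a u1) (expo gen_a u1) u2 = 0%R; last by rewrite add0r addr0.
case: e2 n2 => [-> //|[v ->]]; rewrite inE negb_or => /andP[_ nv] /=.
apply/eqP; apply: contraTT isT => /(level_expo_monotone nv).
rewrite /sgn; case: (s); lia.
Qed.

(** Both ends of the block are levels of absolute value at most the length of
w: an end of u, or the level of a letter t. *)
Lemma t_block_bound s w u u1 b u2 : weq relator u w -> (gen_t, ~~ s) \notin u ->
  block_of (gen_t, s) u u1 b u2 -> `|expo gen_a b| <= size w + size w.
Proof.
move=> uw nu [eu tb e1 e2].
have level v1 v2 : u = v1 ++ (gen_t, s) :: v2 -> `|expo gen_a v1| <= size w.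
  move=> euv; have : level_expo 0 (expo gen_a v1) w != 0%R.
    rewrite -(weq_level_expo _ _ uw) euv; apply: t_level.
    by move: nu; rewrite euv !mem_cat inE !negb_or => /and3P[-> _ ->].
  by move/level_expo_support; rewrite subr0.
have l1 : `|expo gen_a u1| <= size w.
  case: e1 eu => [->|[v ->]] eu; first by [].
  rewrite -cats1 expo_cat /= !addr0; apply: (level v (b ++ u2)).
  by rewrite eu cat_rcons.
have l2 : `|expo gen_a (u1 ++ b)| <= size w.
  case: e2 eu => [->|[v ->]] eu; last by apply: (level (u1 ++ b) v); rewrite -catA.
  by rewrite -[u1 ++ b]cats0 -catA -eu (weq_expo _ uw) expo_le.
by move: l2; rewrite expo_cat; lia.
Qed.

Definition length_bound n := n + (n + n) * n.+1.

(** If l is x or its inverse, the letters of u on x have the opposite sign, so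
their number is the absolute value of an exponent sum, which w shares. *)
Lemma size_Magnus_word l u w : reduced u -> l \notin u -> weq relator u w ->
  size u <= length_bound (size w).
Proof.
case: l => x c ru; rewrite -[c]negbK; set s := ~~ c => nu uw.
have ce : count_mem (x, s) u <= size w.
  have := expo_le x w; rewrite -(weq_expo _ uw) (expo_sgn nu) /sgn.
  by move: (count _ u) => k; case: (s); lia.
have [y xy Hb] : exists2 y, x != y & forall u1 b u2,
    block_of (x, s) u u1 b u2 -> `|expo y b| <= size w + size w.
  case: x nu {ce} => nu; [exists gen_t => // | exists gen_a => //] => u1 b u2 B.
    by apply: leq_trans (a_block_bound uw nu B) _; lia.
  exact: (t_block_bound uw nu B).
apply: leq_trans (size_le_blocks xy ru nu Hb) _.
by rewrite /length_bound leq_add // leq_mul.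
Qed.

(** * Membership *)

Lemma submonoid_generatedP (S : set (letter generator)) g :
  submonoid_generated (letter_val (or_gen relator) @` S)%classic g <->
  exists2 u, all (fun l => `[< S l >]) u & g = word_val (or_gen relator) u.
Proof.
split; last first.
  case=> u /allP Su -> M [[M1 MM] SM].
  elim: u Su => [|l u IH] Su; first by rewrite /word_val big_nil.
  rewrite /word_val big_cons; apply: MM.
    by apply: SM; exists l => //; apply/asboolP/Su; rewrite inE eqxx.
  by apply: IH => k ku; apply: Su; rewrite inE ku orbT.
pose W := [set h | exists2 u : word generator,
  all (fun l => `[< S l >]) u & h = word_val (or_gen relator) u]%classic.
move/(_ W); apply; split; last first.
  move=> _ [l Sl <-]; exists [:: l]; first by rewrite /= andbT; exact/asboolP.
  by rewrite /word_val big_seq1.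
split; first by exists [::] => //; rewrite /word_val big_nil.
move=> _ _ [u Su ->] [v Sv ->]; exists (u ++ v); first by rewrite all_cat Su.
by rewrite /word_val big_cat.
Qed.

Theorem proposition4p14 (M : set (one_relator relator)) :
  Magnus_submonoid M -> membership_decidable (or_gen relator) M.
Proof.
case=> _ [S [_ properS] ->].
have [l0 nS] : exists l, ~ S l.
  by apply/not_existsP => allS; apply: properS => l _; apply: contrapT; exact: allS.
pose Sb l := `[< S l >].
pose K := #|{: letter generator}|.
(* B n exceeds the codes of all words of length at most length_bound n. *)
pose B n := iter (length_bound n) (fun x => x * K.+1) 1.
have BE n : B n = K.+1 ^ length_bound n.
  by rewrite /B; elim: (length_bound n) => //= k ->; rewrite expnSr.
have rB : rec1 B.
  exact: (rec1_iter (rec1D rec1_id (rec1M (rec1D rec1_id rec1_id)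
    (rec1S rec1_id))) (rec1_cst 1) (rec1M rec1_id (rec1_cst K.+1))).
have := rtest_search (rec1_code_run Sb) (rec1_code_run predT) rB.
set f := fun _ => _; move=> rf.
exists (fun v => f (thead v)); first exact: rf.
move=> w; rewrite /f theadE /=; congr (nat_of_bool _); apply/asbool_equiv_eq.
rewrite submonoid_generatedP; split.
  case=> k _; have [u <-] := code_surj k.
  rewrite !code_runE filter_predT => /code_nf_inj/nfP uw.
  exists (filter Sb u); first exact: filter_all.
  by apply/word_valP/weq_sym.
case=> v Sv /word_valP wv.
have [u [ru uv suv]] := free_reduction v.
have Su : all Sb u by apply/allP => l /suv; move/allP: Sv; apply.
have uw := weq_trans uv (weq_sym wv).
have l0u : l0 \notin u by apply/negP => /(allP Su)/asboolP.
exists (code u); last by rewrite !code_runE filter_predT (all_filterP Su); congr code_nf; apply/nfP.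
have := size_Magnus_word ru l0u uw => le_u.
rewrite BE; apply: leq_trans (ltnW (code_lt u)) _.
rewrite leq_pexp2l //; apply: leq_trans le_u _.
have := size_le_code w.
rewrite /length_bound => le; rewrite leq_add // leq_mul //.
by rewrite leq_add.
Qed.
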